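(* Let $T$ be the binary tree. The process $$X'_t:=(|t|+1)^{-1}\sum_{v\preceq t}\xi_v,\qquad t\in T,$$ is a.s. bounded, while the process $$X''_t:=\sum_{v\preceq t}(|v|+1)^{-1}\xi_v,\qquad t\in T,$$ is a.s. unbounded.
   Context: The binary tree is the infinite rooted tree with root $\mathbf 0$ in which every element has exactly two offspring. $t\preceq s$ means that $t$ lies on the branch connecting $\mathbf 0$ with $s$ (including $t=s$); $t\prec s$ means $t\preceq s$, $t\neq s$; $|s|:=\#\{t\in T:t\prec s\}$. $(\xi_v)_{v\in T}$ are i.i.d. standard normal random variables. A process $X$ is a.s. bounded if $\mathbb P(\sup_{t\in T}|X_t|<\infty)=1$, and a.s. unbounded if $\mathbb P(\sup_{t\in T}|X_t|=\infty)=1$. *)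

(* Defs.v *)
From mathcomp Require Import all_boot all_order all_algebra finmap.
From mathcomp Require Import all_classical all_reals all_analysis.

Set Implicit Arguments.
Unset Strict Implicit.
Unset Printing Implicit Defensive.

Import Order.TTheory GRing.Theory Num.Theory.
Import numFieldNormedType.Exports.

Local Open Scope classical_set_scope.
Local Open Scope ring_scope.

(* A vertex is the word of left/right choices leading to it from the root
   [::]; the two offspring of t are rcons t false and rcons t true, so the
   vertices on the branch from the root to s are exactly the prefixes of s. *)
Definition binary_tree : countType := seq bool.

Definition tree_le (t s : binary_tree) : bool := prefix t s.

Definition tree_lt (t s : binary_tree) : bool := tree_le t s && (t != s).

Definition depth (s : binary_tree) : nat :=
  #|` fset_set [set t | tree_lt t s] |%fset.

Lemma tree_leP (t s : binary_tree) :
  reflect (exists2 k, (k <= size s)%N & t = take k s) (tree_le t s).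
Proof.
apply: (iffP idP) => [ts|[k _ ->]]; last exact: prefix_take.
exists (size t); first exact: size_prefix.
by move: ts; rewrite /tree_le prefixE => /eqP.
Qed.

Lemma finite_tree_le (s : binary_tree) : finite_set [set t | tree_le t s].
Proof.
apply: (@sub_finite_set _ _ ((take^~ s) @` `I_(size s).+1)).
  by move=> t /= /tree_leP[k ks ->]; exists k.
exact/finite_image/finite_II.
Qed.

Lemma depthE (s : binary_tree) : depth s = size s.
Proof.
rewrite /depth; have -> : [set t | tree_lt t s] =
    [set` [fset take k s | k in iota 0 (size s)]%fset].
  apply/seteqP; split => [t /= /andP[/tree_leP[k ks ->]] kNs|t /=].
    apply/imfsetP; exists k => //=; rewrite mem_iota add0n /=.
    rewrite ltn_neqAle ks andbT; apply: contraNN kNs => /eqP ->.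
    by rewrite take_size.
  move=> /imfsetP[k /=]; rewrite mem_iota add0n /= => ks ->.
  apply/andP; split; first exact: prefix_take.
  apply: contraTneq (ks) => /(congr1 size).
  by rewrite size_takel ?(ltnW ks)// => ->; rewrite ltnn.
rewrite set_fsetK card_in_imfset ?size_iota//=; last first.
  move=> i j; rewrite !mem_iota !add0n /= => ilt jlt /(congr1 size).
  by rewrite !size_takel // ltnW.
by rewrite undup_id ?size_iota ?iota_uniq.
Qed.

Section processes.
Context (R : realType) (d : measure_display) (Omega : measurableType d).
Variable P : probability Omega R.

Definition mutually_independent (I : choiceType) (X : I -> {RV P >-> R}) :=
  forall (J : {fset I}) (A : I -> set R),
    (forall i, i \in J -> measurable (A i)) ->
    P (\bigcap_(i in [set` J]) (X i @^-1` A i)) =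
    (\prod_(i <- J) P (X i @^-1` A i))%E.

Definition standard_normal (X : {RV P >-> R}) :=
  forall A : set R, measurable A -> distribution P X A = normal_prob 0 1 A.

Definition sup_abs (T : Type) (X : T -> Omega -> R) (w : Omega) : \bar R :=
  ereal_sup (range (fun t => `|X t w|%:E)).

Definition as_bounded (T : Type) (X : T -> Omega -> R) : Prop :=
  P [set w | (sup_abs X w < +oo)%E] = 1%E.

Definition as_unbounded (T : Type) (X : T -> Omega -> R) : Prop :=
  P [set w | sup_abs X w = +oo%E] = 1%E.

End processes.

(* Main.v *)
(* Bounded part: [exp |S_t|], where [S_t] is the sum over the branch of [t], has
   mean at most [2 exp ((|t|+1)/2)], so [W := sum_t exp (- 5/2 (|t|+1)) (exp S_t +
   exp (- S_t))] has finite mean in spite of the [2^n] vertices at depth [n]; where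
   [W] is finite, [|S_t| <= 5/2 (|t|+1) + ln W] for all [t].

   Unbounded part: walk from the root, going to the first child if its variable
   exceeds [1] and to the second child otherwise. The step to depth [k+1] adds
   to [X''] a drift of order [1/(k+2)] and a fluctuation of variance of order
   [1/(k+2)^2]. Hence [E exp (- X'')] at depth [n] of this walk is a product of
   factors [1 - p/(2(k+2)) + O(1/(k+2)^2)], with [p = P(xi > 1) > 0], which tends
   to [0], while it is at least [exp (- M) P(sup |X''| <= M)]. *)
Require Import Defs.
From mathcomp Require Import all_boot all_order all_algebra finmap.
From mathcomp Require Import all_classical all_reals all_analysis.
From mathcomp Require Import measurable_realfun ring lra.

Set Implicit Arguments.
Unset Strict Implicit.
Unset Printing Implicit Defensive.

Import Order.TTheory GRing.Theory Num.Theory.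
Import numFieldNormedType.Exports.
Import HBNNSimple.

Local Open Scope classical_set_scope.
Local Open Scope ring_scope.

(** * Weighted change of variables *)

(** Simple functions and monotone convergence carry the identity from indicators to nonnegative [f].
    It serves both to bring in the normal density ([Z] the density, [X] the identity) and to split
    off one independent variable ([Z] the product of the other factors). *)
Lemma ge0_integral_density d d' (T : measurableType d) (T' : measurableType d')
    (R : realType) (mu : {measure set T -> \bar R})
    (nu : {measure set T' -> \bar R}) (X : T -> T') (Z : T -> R) :
  measurable_fun setT X -> measurable_fun setT Z -> (forall w, 0 <= Z w) ->
  (forall A, measurable A ->
     (\int[mu]_w (\1_A (X w) * Z w)%:E = nu A)%E) ->
  forall f : T' -> R, measurable_fun setT f -> (forall x, 0 <= f x) ->
  (\int[mu]_w (f (X w) * Z w)%:E = \int[nu]_x (f x)%:E)%E.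
Proof.
move=> mX mZ Z0 XZ f mf f0.
have mg (g : T' -> R) : measurable_fun setT g ->
    measurable_fun setT (EFin \o (fun w => g (X w) * Z w)).
  move=> mg; apply/measurable_EFinP/measurable_funM => //.
  exact: measurableT_comp.
have mfE : measurable_fun setT (EFin \o f) by exact/measurable_EFinP.
pose g := nnsfun_approx measurableT mfE.
have gf x : (g n x)%:E @[n --> \oo] --> (f x)%:E.
  by apply: cvg_nnsfun_approx => // y _; rewrite lee_fin.
have gnd x : nondecreasing_seq (g ^~ x).
  by move=> m n mn; have /lefP := nd_nnsfun_approx measurableT mfE mn; exact.
have simple n : (\int[mu]_w (g n (X w) * Z w)%:E = \int[nu]_x (g n x)%:E)%E.
  pose h y x : R := y * \1_(g n @^-1` [set y]) x.
  have h0 y x : 0 <= h y x.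
    rewrite /h indicE; case: (boolP (x \in _)); last by rewrite mulr0.
    by rewrite inE /= => <-; rewrite mulr1.
  have mh y : measurable_fun setT (h y) by exact: measurable_funM.
  pose S : seq R := fset_set (range (g n)).
  have gE x : g n x = \sum_(y <- S) h y x by rewrite fimfunE fsbig_finite.
  transitivity (\int[mu]_w \sum_(y <- S) (h y (X w) * Z w)%:E)%E.
    by apply: eq_integral => w _; rewrite gE mulr_suml sumEFin.
  rewrite ge0_integral_sum//; last 2 first.
  - by move=> y; exact: mg.
  - by move=> y w _; rewrite lee_fin mulr_ge0.
  under [RHS]eq_integral do rewrite gE -sumEFin.
  rewrite ge0_integral_sum//; last 2 first.
  - by move=> y; exact/measurable_EFinP.
  - by move=> y x _; rewrite lee_fin.
  apply: eq_big_seq => y; rewrite /S in_fset_set// inE => -[x _ gxy].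
  have y0 : 0 <= y by rewrite -gxy.
  under eq_integral do rewrite /h -mulrA EFinM.
  under [in RHS]eq_integral do rewrite /h EFinM.
  rewrite !ge0_integralZl//.
  - by rewrite XZ// integral_indic// setIT.
  - exact/measurable_EFinP.
  - by apply: (mg (\1_(g n @^-1` [set y]))).
  - by move=> w _; rewrite lee_fin mulr_ge0.
have mono : (\int[mu]_w (f (X w) * Z w)%:E =
    limn (fun n => \int[mu]_w (g n (X w) * Z w)%:E))%E.
  rewrite -monotone_convergence//.
  - apply: eq_integral => w _; apply/esym/cvg_lim => //.
    under eq_fun do rewrite EFinM.
    rewrite EFinM; apply: cvgeZr => //.
  - by move=> n; exact: mg.
  - by move=> n w _; rewrite lee_fin mulr_ge0.
  - by move=> w _ m n mn; rewrite lee_fin ler_wpM2r// gnd.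
have mono' : (\int[nu]_x (f x)%:E = limn (fun n => \int[nu]_x (g n x)%:E))%E.
  rewrite -monotone_convergence//.
  - by apply: eq_integral => w _; exact/esym/cvg_lim.
  - by move=> n; exact/measurable_EFinP.
  - by move=> n w _; rewrite lee_fin.
  - by move=> w _ m n mn; rewrite lee_fin gnd.
by rewrite mono mono'; congr (limn _); apply/funext.
Qed.

(** * Independence: expectations of products factor *)

Section independence.
Context (R : realType) (d : measure_display) (Omega : measurableType d).
Variables (P : probability Omega R) (I : choiceType) (X : I -> {RV P >-> R}).
Hypothesis X_indep : mutually_independent X.

(** A product of indicators is the indicator of an intersection, so this is mutual independence,
    rephrased for a list with distinct indices. *)
Lemma expectation_prod_indic (s : seq (I * set R)) :
  uniq (map fst s) -> (forall p, p \in s -> measurable p.2) ->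
  (\int[P]_w (\prod_(p <- s) \1_(p.2) (X p.1 w))%:E =
   \prod_(p <- s) \int[P]_w (\1_(p.2) (X p.1 w))%:E)%E.
Proof.
(* [A] looks up the set paired with an index, with [set0] as value off the list; distinctness of the
   indices makes it recover every pair of [s]. *)
move=> us ms; pose A i := nth (set0 : set R) (map snd s) (index i (map fst s)).
have sA : s = [seq (i, A i) | i <- map fst s].
  case: s us @A {ms} => [//|[i0 A0] s'] us A.
  apply: (@eq_from_nth _ (i0, A0)); first by rewrite !size_map.
  move=> k ks; rewrite (nth_map i0) ?size_map// /A.
  rewrite index_uniq ?size_map// !(nth_map (i0, A0))//.
  by case: nth.
pose J := [fset i in map fst s]%fset.
have mA i : i \in map fst s -> measurable (A i).
  move=> si; have /ms // : (i, A i) \in s.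
  by rewrite sA; apply: (map_f (fun i => (i, A i))).
have Js : perm_eq (enum_fset J) (map fst s).
  rewrite uniq_perm ?fset_uniq// => i.
  by rewrite -[LHS]/(i \in J) !inE.
have mXA i : i \in map fst s -> measurable (X i @^-1` A i).
  move=> si; rewrite -[X in measurable X]setTI.
  by apply: measurable_funPT => //; exact: mA.
have mJ i : i \in J -> measurable (A i) by rewrite !inE; exact: mA.
have := X_indep mJ.
rewrite (perm_big _ Js)/= => E.
rewrite [in RHS]sA big_map.
transitivity (\prod_(i <- map fst s) P (X i @^-1` A i))%E; last first.
  apply: eq_big_seq => i si /=.
  by rewrite -[X in P X]setIT -integral_indic//; exact: mXA.
rewrite -E.
have mB : measurable (\bigcap_(i in [set` J]) (X i @^-1` A i)).
  by apply: fin_bigcap_measurable => // i /=; rewrite !inE; exact: mXA.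
rewrite -[X in P X]setIT -integral_indic//; apply: eq_integral => w _.
congr EFin; rewrite sA big_map /= indicE; case: (boolP (w \in _)) => [|].
  rewrite inE => wB; rewrite big_seq big1// => i si.
  by rewrite indicE mem_set//; apply: wB; rewrite /= !inE.
move=> wB; have [i si nAi] : exists2 i, i \in map fst s & ~ A i (X i w).
  apply: contrapT => h; move/negP: wB; apply; rewrite inE => i /=.
  by rewrite !inE => si; apply: contrapT => nA; apply: h; exists i.
by rewrite (big_rem i)//= indicE memNset// mul0r.
Qed.

Lemma expectation_prod_indep (s : seq (I * (R -> R))) :
  uniq (map fst s) ->
  (forall p, p \in s -> measurable_fun setT p.2) ->
  (forall p, p \in s -> forall x, 0 <= p.2 x) ->
  (forall p, p \in s -> \int[P]_w (p.2 (X p.1 w))%:E < +oo)%E ->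
  (\int[P]_w (\prod_(p <- s) p.2 (X p.1 w))%:E =
   \prod_(p <- s) \int[P]_w (p.2 (X p.1 w))%:E)%E.
Proof.
move=> us ms s0 soo.
(* The factors are turned from indicators into arbitrary functions one by one. *)
suff mix (q : seq (I * set R)) :
    uniq (map fst s ++ map fst q) -> (forall p, p \in q -> measurable p.2) ->
    (\int[P]_w ((\prod_(p <- s) p.2 (X p.1 w)) *
                \prod_(p <- q) \1_(p.2) (X p.1 w))%:E =
     (\prod_(p <- s) \int[P]_w (p.2 (X p.1 w))%:E) *
     \prod_(p <- q) \int[P]_w (\1_(p.2) (X p.1 w))%:E)%E.
  have := mix [::]; rewrite cats0 big_nil mule1 => <- //.
  by under [in RHS]eq_integral do rewrite big_nil mulr1.
elim: s us ms s0 soo q => [_ _ _ _ q uq mq|[i f] s IH us ms s0 soo q usq mq].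
  rewrite big_nil mul1e -expectation_prod_indic//.
  by apply: eq_integral => w _; rewrite big_nil mul1r.
move: us => /= /andP[i_s us].
have mf : measurable_fun setT f by apply: (ms (i, f)); rewrite mem_head.
have f0 : forall x, 0 <= f x by apply: (s0 (i, f)); rewrite mem_head.
have ms' p : p \in s -> measurable_fun setT p.2.
  by move=> sp; apply: ms; rewrite in_cons sp orbT.
have s0' p : p \in s -> forall x, 0 <= p.2 x.
  by move=> sp; apply: s0; rewrite in_cons sp orbT.
have soo' p : p \in s -> (\int[P]_w (p.2 (X p.1 w))%:E < +oo)%E.
  by move=> sp; apply: soo; rewrite in_cons sp orbT.
have {}IH := IH us ms' s0' soo'.
move: usq => /= /andP[]; rewrite mem_cat => /norP[i_ns iq] usq.
pose Z w := (\prod_(p <- s) p.2 (X p.1 w)) * \prod_(p <- q) \1_(p.2) (X p.1 w).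
have mZ : measurable_fun setT Z.
  apply: measurable_funM; apply: measurable_prod => p sp.
    by apply: measurableT_comp => //; exact: ms'.
  by apply: measurableT_comp => //; apply: measurable_indic; exact: mq.
have Z0 w : 0 <= Z w.
  apply: mulr_ge0; rewrite big_seq; apply: prodr_ge0 => p sp //.
  exact: s0'.
pose c := (\prod_(p <- s) \int[P]_w (p.2 (X p.1 w))%:E *
           \prod_(p <- q) \int[P]_w (\1_(p.2) (X p.1 w))%:E)%E.
(* Finite expectations make [c] a nonnegative real, by which the law of [X i] can be scaled. *)
have c_fin : c \is a fin_num.
  rewrite /c fin_numM// big_seq; apply: prode_fin_num => p sp.
    rewrite ge0_fin_numE ?soo'// integral_ge0// => w _.
    by rewrite lee_fin s0'.
  have mXA : measurable (X p.1 @^-1` p.2).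
    by rewrite -[X in measurable X]setTI; apply: measurable_funPT => //; exact: mq.
  under eq_integral do rewrite -[\1__ (X _ _)]/(\1_(X p.1 @^-1` p.2) _).
  by rewrite integral_indic// setIT fin_num_measure.
have c0 : 0 <= fine c.
  rewrite fine_ge0// mule_ge0// big_seq; apply: prode_ge0 => p sp;
    apply: integral_ge0 => w _; rewrite lee_fin//.
  exact: s0'.
(* The induction hypothesis, with [(i, A)] added to the indicators, says that weighting by [Z] turns
   the law of [X i] into [c] times itself. *)
have XZ A : measurable A -> (\int[P]_w (\1_A (X i w) * Z w)%:E =
    mscale (NngNum c0) (distribution P (X i)) A)%E.
  move=> mA; have := IH ((i, A) :: q); rewrite big_cons muleCA => IHA.
  rewrite /mscale/= fineK// -/c muleC.
  have mXA : measurable (X i @^-1` A).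
    by rewrite -[X in measurable X]setTI; exact: measurable_funPT.
  transitivity (\int[P]_w (\1_A (X i w))%:E * c)%E; last first.
    rewrite -[RHS]/(P (X i @^-1` A) * c)%E; congr (_ * _)%E.
    by rewrite -[X in P X]setIT -integral_indic.
  rewrite -IHA.
  - by apply: eq_integral => w _; rewrite /Z big_cons mulrCA.
  - rewrite (perm_uniq (permEl (perm_catCA (map fst s) [:: i] (map fst q))))/=.
    by rewrite mem_cat negb_or i_ns iq.
  - by move=> p; rewrite in_cons => /predU1P[->//|]; exact: mq.
under eq_integral do rewrite big_cons -mulrA -/(Z _).
rewrite (ge0_integral_density _ mZ Z0 XZ)//.
rewrite ge0_integral_mscale//; last 2 first.
- exact/measurable_EFinP.
- by move=> x _; rewrite lee_fin.
rewrite ge0_integral_distribution//=.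
  by rewrite fineK// /c big_cons muleC muleA.
exact/measurable_EFinP.
Qed.
End independence.

(** * The standard normal law: exponential moments and tail *)

Section standard_normal.
Context (R : realType) (d : measure_display) (Omega : measurableType d).
Variables (P : probability Omega R) (X : {RV P >-> R}).
Hypothesis X_normal : standard_normal X.

Lemma expectation_normal (f : R -> R) : measurable_fun setT f ->
  (forall x, 0 <= f x) ->
  (\int[P]_w (f (X w))%:E =
   \int[lebesgue_measure]_x (f x * normal_pdf 0 1 x)%:E)%E.
Proof.
move=> mf f0.
rewrite (@ge0_integral_density _ _ (measurableTypeR R) R _ lebesgue_measure
  (distribution P X) idfun)//.
- by rewrite ge0_integral_distribution//; exact/measurable_EFinP.
- by move=> _ B mB; rewrite setTI.
- exact: measurable_normal_pdf.
- exact: normal_pdf_ge0.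
- move=> A mA; transitivity (normal_prob 0 1 A); last exact/esym/X_normal.
  rewrite /normal_prob [RHS]integral_mkcond.
  apply: eq_integral => x _; rewrite patchE indicE.
  by case: ifP; rewrite ?mul1r ?mul0r.
Qed.

(** Completing the square leaves [expR (a ^+ 2 / 2)] times the normal density of mean [a], which has
    integral 1. *)
Lemma normal_mgf (a : R) :
  (\int[P]_w (expR (a * X w))%:E = (expR (a ^+ 2 / 2))%:E)%E.
Proof.
rewrite (@expectation_normal (fun x => expR (a * x))); last 2 first.
- by apply: measurableT_comp => //; exact: measurable_funM.
- by move=> x; exact: expR_ge0.
have E x : expR (a * x) * normal_pdf 0 1 x = expR (a ^+ 2 / 2) * normal_pdf a 1 x.
  rewrite !normal_pdfE ?oner_eq0// mulrCA [RHS]mulrCA; congr (_ * _).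
  by rewrite /normal_fun -!expRD; congr expR; lra.
under eq_integral do rewrite E EFinM.
rewrite ge0_integralZl ?integral_normal_pdf ?mule1//.
- by apply/measurable_EFinP; exact: measurable_normal_pdf.
- by move=> x _; rewrite lee_fin normal_pdf_ge0.
Qed.

(** On []1, 2]], an interval of length 1, the density is at least its value at 2. *)
Lemma normal_tail_gt0 : (0 < P (X @^-1` `]1%R, +oo[))%E.
Proof.
have -> : P (X @^-1` `]1, +oo[) = normal_prob 0 1 (`]1, +oo[ : set R).
  exact: X_normal.
rewrite /normal_prob.
pose c := normal_pdf 0 1 2%:R : R.
have c0 : 0 < c.
  rewrite /c normal_pdfE ?oner_eq0// mulr_gt0 ?normal_peak_gt0 ?oner_eq0//.
  exact: expR_gt0.
have m2 : measurable (`]1, 2] : set R) by exact: measurable_itv.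
apply: (@lt_le_trans _ _ (\int[lebesgue_measure]_(x in `]1%R, 2%R]) c%:E)%E).
  rewrite integral_cst//= lebesgue_measure_itv/= lte_fin ltrDl ltr01.
  by rewrite -EFinD mule_gt0// lte_fin//; lra.
apply: (@le_trans _ _
    (\int[lebesgue_measure]_(x in `]1%R, 2%R]) (normal_pdf 0 1 x)%:E)%E).
  apply: ge0_le_integral => //=.
  - by move=> x _; rewrite lee_fin ltW.
  - apply: measurable_funTS; apply/measurable_EFinP.
    exact: measurable_normal_pdf.
  - move=> x; rewrite in_itv/= => /andP[x1 x2].
    rewrite lee_fin /c !normal_pdfE ?oner_eq0//.
    rewrite ler_wpM2l ?normal_peak_ge0// ler_expR; nra.
apply: ge0_subset_integral => //.
- by apply: measurable_funTS; apply/measurable_EFinP; exact: measurable_normal_pdf.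
- by move=> x _; rewrite lee_fin normal_pdf_ge0.
- by move=> x /=; rewrite !in_itv/= andbT => /andP[].
Qed.

End standard_normal.

(** * Branches and levels of the binary tree *)

(* Vertices are handled through their reversed words, so that the offspring of
   [rev r] are the words [rev (b :: r)]; [branch r] lists the ancestors of
   [rev r]. *)
Fixpoint branch (r : seq bool) : seq binary_tree :=
  if r is _ :: r' then rev r :: branch r' else [:: [::]].

Fixpoint words (n : nat) : seq (seq bool) :=
  if n is m.+1 then
    [seq true :: r | r <- words m] ++ [seq false :: r | r <- words m]
  else [:: [::]].

Lemma mem_words n (r : seq bool) : (r \in words n) = (size r == n).
Proof.
elim: n r => [|n IH] [|b r] //=; rewrite mem_cat.
  by apply/orP => -[] /mapP[].
rewrite eqSS -IH; have consP b' : (b :: r \in [seq b' :: r | r <- words n]) =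
    (b == b') && (r \in words n).
  apply/mapP/andP => [[r' r'n [-> ->]]|[/eqP-> rn]]; last by exists r.
  by rewrite eqxx.
by rewrite !consP => {consP}; case: b; rewrite ?orbF.
Qed.

Lemma size_words n : size (words n) = (2 ^ n)%N.
Proof. by elim: n => //= n IH; rewrite size_cat !size_map IH addnn -mul2n expnS. Qed.

Lemma big_wordsS (R : nmodType) (F : seq bool -> R) n :
  \sum_(r <- words n.+1) F r =
  \sum_(r <- words n) (F (true :: r) + F (false :: r)).
Proof. by rewrite /= big_cat/= !big_map big_split. Qed.

(** A prefix of [rcons t b] either has length at most that of [t], and is then a prefix of [t], or
    is the whole word. *)
Lemma tree_le_rev (v : binary_tree) (r : seq bool) :
  tree_le v (rev r) = (v \in branch r).
Proof.
rewrite /tree_le; elim: r => [|b r IH]; first by rewrite -[rev _]/[::] prefixs0 inE.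
rewrite [branch _]/= in_cons -IH rev_cons !prefixE.
case: (leqP (size v) (size (rev r))) => vr.
  rewrite -cats1 takel_cat//; case: (eqVneq v (_ ++ _)) => [vE|//].
  by move: vr; rewrite vE size_cat addn1 ltnn.
rewrite (@take_oversize _ _ (rcons _ _)) ?size_rcons//.
rewrite (@take_oversize _ _ (rev r)) 1?ltnW// eq_sym.
case: (eqVneq v (rcons _ _)) => //= _.
by apply/esym/negbTE; apply: contraTneq vr => ->; rewrite ltnn.
Qed.

Lemma size_mem_branch v r : v \in branch r -> (size v <= size r)%N.
Proof. by rewrite -tree_le_rev => /size_prefix; rewrite size_rev. Qed.

Lemma branch_uniq r : uniq (branch r).
Proof.
elim: r => //= b r ->; rewrite andbT.
by apply: contraTN (leqnn (size r).+1) => /size_mem_branch; rewrite size_rev /= -ltnNge.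
Qed.

Lemma size_branch r : size (branch r) = (size r).+1.
Proof. by elim: r => //= _ r ->. Qed.

Lemma sum_branch (R : realType) (F : binary_tree -> R) (r : seq bool) :
  \sum_(v \in [set v | tree_le v (rev r)]) F v = \sum_(v <- branch r) F v.
Proof.
have -> : [set v | tree_le v (rev r)] = [set` branch r].
  by apply/seteqP; split => v /=; rewrite tree_le_rev.
by rewrite -fsbig_seq ?branch_uniq.
Qed.

(** * Measurability of boundedness events *)

Section sup_abs.
Context (R : realType) (d : measure_display) (Omega : measurableType d).
Variables (P : probability Omega R).

(** Integer bounds [M] make the union countable, which is what measurability and the null-set
    argument below rely on. *)
Lemma sup_abs_ltyE (T : Type) (X : T -> Omega -> R) :
  [set w | (sup_abs X w < +oo)%E] =
  \bigcup_M \bigcap_t [set w | `|X t w| <= M%:R].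
Proof.
apply/seteqP; split => w /=; last first.
  move=> [M _ XM]; apply: (@le_lt_trans _ _ (M%:R)%:E); last exact: ltry.
  by apply: ge_ereal_sup => _ [t _ <-]; rewrite lee_fin; exact: XM.
move=> supXw; have ub t : (`|X t w|%:E <= sup_abs X w)%E.
  by apply: ereal_sup_ubound; exists t.
case: (sup_abs X w) supXw ub => [s _ ub|//|_ ub].
  exists (Num.truncn s).+1 => // t _ /=.
  by rewrite (le_trans _ (ltW (truncnS_gt s)))// -lee_fin.
(* A supremum equal to [-oo] means that there is no index at all, so any bound will do. *)
by exists 0%N => // t _; have := ub t; rewrite leeNy_eq.
Qed.

(** The index type is enumerated through its codes; a code that decodes to nothing contributes the
    full set. *)
Lemma measurable_bounded (T : countType) (X : T -> Omega -> R) (M : R) :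
  (forall t, measurable_fun setT (X t)) ->
  measurable (\bigcap_t [set w | `|X t w| <= M]).
Proof.
move=> mX; rewrite (_ : \bigcap_t _ = \bigcap_n
    (if @choice.unpickle T n is Some t then [set w | `|X t w| <= M] else setT)).
  apply: bigcapT_measurable => n; case: (@choice.unpickle T n) => // t.
  rewrite -[X in measurable X]setTI; apply: measurable_fun_le => //.
  exact: measurableT_comp.
apply/seteqP; split => w wX.
  by move=> n _; case: (@choice.unpickle T n) => // t; exact: wX.
by move=> t _; have := wX (choice.pickle t) I; rewrite choice.pickleK.
Qed.

Lemma measurable_sup_abs_lty (T : countType) (X : T -> Omega -> R) :
  (forall t, measurable_fun setT (X t)) ->
  measurable [set w | (sup_abs X w < +oo)%E].
Proof.
move=> mX; rewrite sup_abs_ltyE; apply: bigcupT_measurable => M.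
exact: measurable_bounded.
Qed.

Lemma as_unboundedP (T : countType) (X : T -> Omega -> R) :
  (forall t, measurable_fun setT (X t)) ->
  (forall M : nat, P (\bigcap_t [set w | `|X t w| <= M%:R]) = 0%E) ->
  as_unbounded P X.
Proof.
move=> mX X0; rewrite /as_unbounded.
rewrite (_ : [set w | sup_abs X w = +oo%E] = ~` [set w | (sup_abs X w < +oo)%E]).
  rewrite probability_setC; last exact: measurable_sup_abs_lty.
  rewrite sup_abs_ltyE (_ : P _ = 0%E) ?sube0//.
  apply/negligibleP.
    by apply: bigcupT_measurable => M; exact: measurable_bounded.
  apply: negligible_bigcup => M; apply/negligibleP; last exact: X0.
  exact: measurable_bounded.
apply/seteqP; split => w /=; rewrite ltey; first by move=> ->; rewrite eqxx.
by move/negP/negPn/eqP.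
Qed.

End sup_abs.

(** * Boundedness of the branch means *)

Section gaussian_tree.
Context (R : realType) (d : measure_display) (Omega : measurableType d).
Variables (P : probability Omega R) (xi : binary_tree -> {RV P >-> R}).
Hypotheses (xi_indep : mutually_independent xi)
  (xi_normal : forall v, standard_normal (xi v)).

Let S r w := \sum_(v <- branch r) xi v w.

Let mS r : measurable_fun setT (S r).
Proof. by apply: measurable_sum => v. Qed.

(** The branch has [(size r).+1] distinct vertices, so independence yields that many factors
    [expR (a ^+ 2 / 2)]. *)
Lemma branch_sum_mgf (a : R) r :
  (\int[P]_w (expR (a * \sum_(v <- branch r) xi v w))%:E =
   (expR (a ^+ 2 / 2 * (size r).+1%:R))%:E)%E.
Proof.
pose s := [seq (v, fun x : R => expR (a * x)) | v <- branch r].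
transitivity (\int[P]_w (\prod_(p <- s) p.2 (xi p.1 w))%:E)%E.
  by apply: eq_integral => w _; rewrite mulr_sumr expR_sum /s big_map.
rewrite expectation_prod_indep//.
- rewrite /s big_map/=; under eq_bigr do rewrite normal_mgf//.
  rewrite prodEFin -expR_sum big_const_seq count_predT size_branch.
  by rewrite iter_addr_0 mulr_natr.
- by rewrite /s -map_comp map_id_in// branch_uniq.
- by move=> p /mapP[v _ ->] /=; apply: measurableT_comp.
- by move=> p /mapP[v _ ->] x /=; exact: expR_ge0.
- by move=> p /mapP[v _ ->] /=; rewrite normal_mgf// ltry.
Qed.

Let W n w : R := \sum_(r <- words n)
  expR (- (5 / 2 * n.+1%:R)) * (expR (S r w) + expR (- S r w)).

Let W_ge0 n w : 0 <= W n w.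
Proof.
by apply: sumr_ge0 => r _; rewrite mulr_ge0 ?addr_ge0 ?expR_ge0.
Qed.

Let mW n : measurable_fun setT (W n).
Proof.
apply: measurable_sum => r; apply: measurable_funM => //.
apply: measurable_funD; apply: measurableT_comp => //.
exact: measurableT_comp.
Qed.

(** With m = n+1, the 2^n words contribute 2 exp(-5m/2) exp(m/2) each, in total (2 exp(-2))^m. The
    constant 5/2 is chosen to beat 1/2 (exponential moment) plus ln 2 (branching) with room for the
    ratio 1/2. *)
Let int_W n : (\int[P]_w (W n w)%:E <= (2^-1 ^+ n.+1)%:E)%E.
Proof.
have mE (b : R) r : measurable_fun setT (fun w => (expR (b * S r w))%:E).
  apply/measurable_EFinP; apply: measurableT_comp => //.
  exact: measurable_funM.
have -> : (\int[P]_w (W n w)%:E = \sum_(r <- words n)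
    (expR (- (5 / 2 * n.+1%:R)) * (expR (2^-1 * (size r).+1%:R) *+ 2))%:E)%E.
  under eq_integral do rewrite -sumEFin.
  rewrite ge0_integral_sum//; last first.
    move=> r; apply/measurable_EFinP; apply: measurable_funM => //.
    apply: measurable_funD; apply: measurableT_comp => //.
    exact: measurableT_comp.
  apply: eq_bigr => r _.
  under eq_integral do rewrite EFinM.
  rewrite ge0_integralZl//; last first.
    apply/measurable_EFinP.
    apply: measurable_funD; apply: measurableT_comp => //.
    exact: measurableT_comp.
  rewrite EFinM; congr (_ * _)%E.
  have E w : ((expR (S r w) + expR (- S r w))%:E =
      (expR (1 * S r w))%:E + (expR (-1 * S r w))%:E)%E.
    by rewrite mul1r mulN1r.
  under eq_integral do rewrite E.
  rewrite ge0_integralD//.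
  by rewrite !branch_sum_mgf -EFinD sqrrN expr1n mul1r.
rewrite sumEFin lee_fin.
have -> : \sum_(r <- words n)
    expR (- (5 / 2 * n.+1%:R)) * (expR (2^-1 * (size r).+1%:R) *+ 2) =
    (2 * expR (- 2)) ^+ n.+1 :> R.
  rewrite (eq_big_seq (fun=> expR (- (2 * n.+1%:R)) *+ 2)); last first.
    move=> r; rewrite mem_words => /eqP ->.
    by rewrite [LHS]mulrnAr -expRD; congr (expR _ *+ _); lra.
  rewrite big_const_seq count_predT size_words iter_addr_0 -mulrnA -expnS.
  by rewrite exprMn -natrX [RHS]mulr_natl -expRM_natr mulNr.
rewrite lerXn2r ?nnegrE ?mulr_ge0 ?expR_ge0//.
(* exp 1 is at least 2, hence exp 2 at least 4 and 2 exp(-2) at most 1/2. *)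
have e1 := expR_ge1Dx (1 : R).
have e2 : 4 <= expR 2 :> R.
  rewrite (_ : 2 = 1 + 1 :> R)// expRD; nra.
by rewrite expRN ler_pdivrMr ?expR_gt0//; lra.
Qed.

Lemma branch_mean_as_bounded : as_bounded P (fun (t : binary_tree) w =>
  ((depth t).+1%:R)^-1 * \sum_(v \in [set v | tree_le v t]) xi v w).
Proof.
set X := (X in as_bounded P X).
have XE r w : X (rev r) w = (size r).+1%:R^-1 * S r w.
  by rewrite /X sum_branch depthE size_rev.
have mX t : measurable_fun setT (X t).
  have -> : X t = fun w => (size (rev t)).+1%:R^-1 * S (rev t) w.
    by apply/funext => w; rewrite -XE revK.
  exact: measurable_funM.
pose V w := (\sum_(n <oo) (W n w)%:E)%E.
have mV : measurable_fun setT V.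
  apply: ge0_emeasurable_sum => [n w _ _|n _].
    by rewrite lee_fin.
  exact/measurable_EFinP.
have V0 w : (0 <= V w)%E by apply: nneseries_ge0 => n _ _; rewrite lee_fin.
have V_lty : (\int[P]_w V w < +oo)%E.
  rewrite integral_nneseries//; last 2 first.
  - by move=> n; exact/measurable_EFinP.
  - by move=> n w _; rewrite lee_fin.
  apply: (@le_lt_trans _ _ 1%:E); last exact: ltry.
  apply: (@le_trans _ _ (\sum_(n <oo) (1 / (2 ^ (n + 0.+1))%:R)%:E)%E).
    apply: lee_nneseries => n.
      by move=> _ _; apply: integral_ge0 => w _; rewrite lee_fin.
    move=> _; apply: (le_trans (int_W n)).
    by rewrite lee_fin addn1 mul1r natrX exprVn.
  have /cvg_lim -> // := @cvg_geometric_eseries_half R 1 0.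
  by rewrite expr0 divr1.
have iV : P.-integrable setT V.
  apply/integrableP; split => //.
  by under eq_integral do rewrite gee0_abs//.
have : {ae P, forall w, (sup_abs X w < +oo)%E}.
  apply: filterS (integrable_ae measurableT iV) => w /(_ Logic.I) Vw.
  set v := fine (V w) in Vw *.
  have v0 : 0 <= v by exact: fine_ge0.
  suff Xv t : `|X t w| <= 5 / 2 + v.
    apply: (@le_lt_trans _ _ (5 / 2 + v)%:E); last exact: ltry.
    by apply: ge_ereal_sup => _ [t _ <-]; rewrite lee_fin.
  rewrite -(revK t); set r := rev t; rewrite XE.
  have n0 : 0 < (size r).+1%:R :> R by rewrite ltr0n.
  rewrite normrM normfV (gtr0_norm n0) ler_pdivrMl//.
  have Wv : W (size r) w <= v.
    rewrite -lee_fin fineK//.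
    have := @nneseries_lim_ge R (fun n => (W n w)%:E) xpredT 0 (size r).+1
      (fun n _ _ => W_ge0 n w).
    apply: le_trans; rewrite big_nat_recr//= leeDr// sume_ge0// => n _.
    by rewrite lee_fin.
  (* The term of [r] in [W] is at most [v], and [v <= expR v] lets [v] stand in for its logarithm.
     Dividing by the length, which is at least 1, then gives [5 / 2 + v]. *)
  have : expR (- (5 / 2 * (size r).+1%:R)) * expR `|S r w| <= expR v.
    apply: (@le_trans _ _ v); last first.
      by rewrite (le_trans _ (expR_ge1Dx v))// lerDr.
    apply: le_trans Wv; rewrite /W (big_rem r)/=; last by rewrite mem_words.
    rewrite -[leLHS]addr0 lerD//.
      rewrite ler_wpM2l ?expR_ge0//.
      by case: (ger0P (S r w)) => _; rewrite ?lerDl ?lerDr expR_ge0.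
    by apply: sumr_ge0 => r' _; rewrite mulr_ge0 ?addr_ge0 ?expR_ge0.
  rewrite -expRD ler_expR => h.
  have : v <= v * (size r).+1%:R by rewrite ler_peMr// ler1n.
  by move: h; lra.
move=> [N [mN N0 NS]].
rewrite /as_bounded; have mB := measurable_sup_abs_lty mX.
rewrite -[X in P X]setCK probability_setC; last exact: measurableC.
rewrite (_ : P _ = 0%E) ?sube0//.
by apply: (subset_measure0 _ mN NS N0); exact: measurableC.
Qed.

End gaussian_tree.

(** * Unboundedness of the weighted sums *)

Lemma shifted_harmonic_dvg (R : realType) (A : R) :
  exists n, A <= \sum_(k < n) k.+2%:R^-1.
Proof.
have nd : nondecreasing_seq (series (@harmonic R)).
  by apply: nondecreasing_series => k _ _; rewrite invr_ge0.
(* The target is [A + 1] because the shifted sum omits the first harmonic term, equal to 1. *)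
have /cvgryPge/(_ (A + 1)) [n _ /(_ n.+1 (leqnSn n))] :=
  nondecreasing_dvgn_lt nd (@dvg_harmonic R).
rewrite /series/= big_nat_recl//= invr1 big_mkord => An.
by exists n; lra.
Qed.

Section gaussian_tree_unbounded.
Context (R : realType) (d : measure_display) (Omega : measurableType d).
Variables (P : probability Omega R) (xi : binary_tree -> {RV P >-> R}).
Hypotheses (xi_indep : mutually_independent xi)
  (xi_normal : forall v, standard_normal (xi v)).

(* Starting at the root, move from a vertex to its [true] child if that child's
   variable exceeds [1], and to its [false] child otherwise. The product of the
   factors [path_weight r] is [exp (- X''_(rev r))] if this path visits [rev r],
   and [0] otherwise. *)
Fixpoint path_weight (r : seq bool) : seq (binary_tree * (R -> R)) :=
  if r is b :: r' then
    let c := (size r).+1%:R^-1 in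
    [:: (rev (true :: r'), if b then fun x => \1_(`]1, +oo[) x * expR (- c * x)
                           else \1_(~` `]1, +oo[)),
        (rev (false :: r'), if b then cst 1 else fun x => expR (- c * x))
      & path_weight r']
  else [:: ([::], fun x => expR (- 1 * x))].

Let G r w := \prod_(p <- path_weight r) p.2 (xi p.1 w).

Let X r w := \sum_(v <- branch r) (size v).+1%:R^-1 * xi v w.

(** The word of the vertex that the walk visits at depth [n]. As all [G r w] are nonnegative, it
    bounds their sum over [words n] from below. *)
Lemma path_weight_selected n w : exists2 r, r \in words n & G r w = expR (- X r w).
Proof.
elim: n => [|n [r rn Gr]].
  exists [::] => //; rewrite /G /X /= !big_seq1 /=.
  by rewrite invr1 mul1r mulN1r.
exists ((xi (rev (true :: r)) w \in `]1, +oo[) :: r).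
  by move: rn; rewrite !mem_words.
rewrite /G /X /= !big_cons -/(G r w) -/(X r w) Gr /=.
case: ifPn => x1; rewrite indicE.
  rewrite mem_set// !mul1r -expRD; congr expR.
  by rewrite size_rev mulNr -opprD.
rewrite mem_set; last by apply/negP.
rewrite mul1r -expRD; congr expR.
by rewrite size_rev mulNr -opprD.
Qed.

(** Each step adds the two children of the current vertex, which differ in their last letter and lie
    deeper than all earlier entries. Independence thus applies to the product [G]. *)
Lemma path_weight_uniq r : uniq (map fst (path_weight r)).
Proof.
have sz r' v : v \in map fst (path_weight r') -> (size v <= size r')%N.
  elim: r' v => [|b r' IH] v /=; first by rewrite inE => /eqP ->.
  rewrite !in_cons => /or3P[/eqP->|/eqP->|/IH/leqW//]; by rewrite size_rev.
elim: r => //= b r ->; rewrite andbT in_cons negb_or !rev_cons.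
rewrite eqseq_rcons andbF /=.
by apply/andP; split; apply/negP => /sz; rewrite size_rcons size_rev ltnn.
Qed.

Let p : R := fine (normal_prob 0 1 (`]1, +oo[ : set R)).

Let tailE v : P (xi v @^-1` `]1, +oo[) = p%:E.
Proof.
rewrite /p -(xi_normal v)//.
by rewrite fineK// fin_num_measure.
Qed.

Let p_gt0 : 0 < p.
Proof. by have := normal_tail_gt0 (xi_normal [::]); rewrite tailE lte_fin. Qed.

Let mtail v : measurable (xi v @^-1` `]1, +oo[).
Proof. by rewrite -[X in measurable X]setTI; exact: measurable_funPT. Qed.

Let p_le1 : p <= 1.
Proof. by rewrite -lee_fin -(tailE [::]) probability_le1. Qed.

(** Source of the drift: where the variable exceeds 1, [expR (- c * x)] is at most [expR (- c)]. *)
Let int_tail (c : R) v : 0 <= c ->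
  (\int[P]_w (\1_(`]1%R, +oo[) (xi v w) * expR (- c * xi v w))%:E
     <= (p * expR (- c))%:E)%E.
Proof.
move=> c0; rewrite mulrC EFinM -(tailE v) -[X in P X]setIT -integral_indic//.
rewrite -ge0_integralZl//; last by apply/measurable_EFinP; exact: measurable_indic.
apply: ge0_le_integral => //.
- apply/measurable_EFinP; apply: measurable_funM.
    by apply: measurableT_comp => //; exact: measurable_indic.
  by apply: measurableT_comp => //; exact: measurable_funM.
- by apply/measurable_EFinP; apply: measurable_funM => //; exact: measurable_indic.
- move=> w _; rewrite -EFinM lee_fin !indicE; case: (boolP (w \in _)).
    rewrite inE /= => x1; rewrite mem_set// mul1r mulr1 ler_expR.
    by move: x1; rewrite in_itv/= andbT => x1; nra.
  by rewrite notin_setE/= => x1; rewrite memNset// mul0r mulr0.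
Qed.

Let int_body v : (\int[P]_w (\1_(~` `]1%R, +oo[) (xi v w))%:E = (1 - p)%:E)%E.
Proof.
transitivity (\int[P]_w (\1_(~` (xi v @^-1` `]1%R, +oo[)) w)%:E)%E; first by [].
rewrite integral_indic//; last exact: measurableC.
by rewrite setIT; apply: etrans (probability_setC P (mtail v)) _; rewrite tailE.
Qed.

Let int1 : (\int[P]_w 1%:E = 1 :> \bar R)%E.
Proof. by rewrite integral_cst// mul1e; exact: probability_setT. Qed.

(** A [true] step costs the tail bound. A [false] step costs the probability [1 - p] of rejecting
    the [true] child times the exponential moment of the independent [false] child. The base value
    is the exponential moment at the root. *)
Fixpoint path_bound (r : seq bool) : R :=
  if r is b :: r' then
    let c := (size r).+1%:R^-1 in
    (if b then p * expR (- c) else (1 - p) * expR (c ^+ 2 / 2)) * path_bound r'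
  else expR (1 / 2).

Let path_weight_good r q : q \in path_weight r ->
  [/\ measurable_fun setT q.2, forall x, 0 <= q.2 x &
      (\int[P]_w (q.2 (xi q.1 w))%:E < +oo)%E].
Proof.
have mexp (c : R) : measurable_fun setT (fun x : R => expR (- c * x)).
  by apply: measurableT_comp => //; exact: measurable_funM.
have exp_lty (c : R) v : (\int[P]_w (expR (- c * xi v w))%:E < +oo)%E.
  by rewrite normal_mgf// ltry.
elim: r => [|b r IH]; first by rewrite inE => /eqP ->; split => //= x; exact: expR_ge0.
rewrite [path_weight _]/= !in_cons => /or3P[/eqP->|/eqP->|/IH//]; case: b => /=.
- split.
  + by apply: measurable_funM => //; exact: measurable_indic.
  + by move=> x; rewrite mulr_ge0 ?expR_ge0.
  + by apply: (le_lt_trans (int_tail _ _)); rewrite ?ltry// invr_ge0.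
- split => //.
  + by apply: measurable_indic; apply: measurableC; exact: measurable_itv.
  + by rewrite int_body ltry.
- split => //.
  by rewrite int1 ltry.
- by split.
Qed.

Lemma path_weight_le r : (\int[P]_w (G r w)%:E <= (path_bound r)%:E)%E.
Proof.
rewrite expectation_prod_indep ?path_weight_uniq//; last 3 first.
- by move=> q /path_weight_good[].
- by move=> q /path_weight_good[].
- by move=> q /path_weight_good[].
have ge0 r' q : q \in path_weight r' -> (0 <= \int[P]_w (q.2 (xi q.1 w))%:E)%E.
  by move=> /path_weight_good[_ q0 _]; apply: integral_ge0 => w _; rewrite lee_fin q0.
elim: r => [|b r IH]; first by rewrite big_seq1/= normal_mgf// sqrrN expr1n.
rewrite [path_weight _]/= !big_cons muleA.
rewrite [path_bound _]/= EFinM; apply: lee_pmul => //.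
- by apply: mule_ge0; apply: (ge0 (b :: r)); rewrite /= !in_cons eqxx ?orbT.
- by rewrite big_seq; apply: prode_ge0 => q; exact: ge0.
- case: b => /=.
    by rewrite int1 mule1 int_tail// invr_ge0.
  by rewrite int_body normal_mgf// -EFinM sqrrN.
Qed.

(** The factor of a step depends only on its letter and its depth, so summing over the letter at
    each level turns the sum over words into a product. *)
Lemma sum_path_bound n : \sum_(r <- words n) path_bound r =
  expR (1 / 2) * \prod_(k < n)
    (p * expR (- k.+2%:R^-1) + (1 - p) * expR (k.+2%:R^-1 ^+ 2 / 2)).
Proof.
elim: n => [|n IH]; first by rewrite /= big_seq1 big_ord0 mulr1.
rewrite big_wordsS big_ord_recr/= mulrA -IH big_distrl/=.
apply: eq_big_seq => r; rewrite mem_words => /eqP ->.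
by rewrite -mulrDl mulrC.
Qed.

(** Each factor is at most exp(-pc/2 + c^2) with c = 1/(k+2), and the squares are dominated by the
    telescoping differences 1/(k+1) - 1/(k+2), whose sum is 1 - 1/(n+1). *)
Let prod_factor_le n : \prod_(k < n)
    (p * expR (- k.+2%:R^-1) + (1 - p) * expR (k.+2%:R^-1 ^+ 2 / 2)) <=
  expR (1 - n.+1%:R^-1 - p / 2 * \sum_(k < n) k.+2%:R^-1).
Proof.
elim: n => [|n IH]; first by rewrite !big_ord0 invr1 subrr mulr0 subrr expR0.
rewrite !big_ord_recr/=; set c : R := n.+2%:R^-1.
have n1 : 0 < n.+1%:R :> R by rewrite ltr0n.
have nE : n.+1%:R^-1 - c = n.+1%:R^-1 * c.
  rewrite /c -(natr1 n.+1); move: (n.+1%:R) n1 => m m0.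
  by field; rewrite !gt_eqF//; lra.
have c0 : 0 < c by rewrite invr_gt0 ltr0n.
have cn : c <= n.+1%:R^-1 by rewrite lef_pV2 ?posrE ?ltr0n// ler_nat.
have c1 : c <= 1 by rewrite invf_le1 ?ltr0n// ler1n.
clearbody c.
(* For c in [0, 1], (1 + c)(1 - c/2) is at least 1; the next bound uses the same inequality with c^2
   in place of c. *)
have e1 : expR (- c) <= 1 - c / 2.
  rewrite expRN invf_ple ?posrE ?expR_gt0//; last by lra.
  apply: le_trans (expR_ge1Dx c); rewrite -div1r ler_pdivrMr; nra.
have e2 : expR (c ^+ 2 / 2) <= 1 + c ^+ 2.
  have : c ^+ 2 <= 1 by rewrite exprn_ile1// ltW.
  move: (c ^+ 2) (sqr_ge0 c) => u u0 u1.
  have := expR_ge1Dx (- (u / 2)); rewrite expRN => h.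
  rewrite -[expR _]invrK invf_ple ?posrE ?invr_gt0 ?expR_gt0//; last by lra.
  by apply: le_trans h; rewrite -div1r ler_pdivrMr; nra.
have step : p * expR (- c) + (1 - p) * expR (c ^+ 2 / 2) <=
    expR (- (p / 2 * c) + c ^+ 2).
  apply: le_trans (expR_ge1Dx _).
  have q0 : 0 <= 1 - p by rewrite subr_ge0.
  have := ler_wpM2l (ltW p_gt0) e1; have := ler_wpM2l q0 e2.
  have := mulr_ge0 (ltW p_gt0) (sqr_ge0 c); nra.
apply: (@le_trans _ _ (expR (1 - n.+1%:R^-1 - p / 2 * \sum_(k < n) k.+2%:R^-1) *
    expR (- (p / 2 * c) + c ^+ 2))).
  apply: ler_pM => //.
    apply: prodr_ge0 => k _; apply: addr_ge0; apply: mulr_ge0;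
    by rewrite ?expR_ge0 ?subr_ge0// ltW.
  by apply: addr_ge0; apply: mulr_ge0; rewrite ?expR_ge0 ?subr_ge0// ltW.
rewrite -expRD ler_expR mulrDr.
have : c ^+ 2 <= n.+1%:R^-1 - c by rewrite nE expr2 ler_wpM2r// ltW.
by move: (n.+1%:R^-1) (p / 2 * _) => m A; lra.
Qed.

Lemma weighted_branch_sum_as_unbounded :
  as_unbounded P (fun (t : binary_tree) w =>
    \sum_(v \in [set v | tree_le v t]) ((depth v).+1%:R)^-1 * xi v w).
Proof.
set Y := (Y in as_unbounded P Y).
have YE r w : Y (rev r) w = X r w.
  by rewrite /Y sum_branch; apply: eq_bigr => v _; rewrite depthE.
have mY t : measurable_fun setT (Y t).
  have -> : Y t = X (rev t) by apply/funext => w; rewrite -YE revK.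
  by apply: measurable_sum => v; exact: measurable_funM.
apply: as_unboundedP => // M; set B := (B in P B).
have mB : measurable B by exact: measurable_bounded.
have mG r : measurable_fun setT (G r).
  apply: measurable_prod => q /path_weight_good[mq _ _].
  exact: measurableT_comp.
have G0 r w : 0 <= G r w.
  by rewrite /G big_seq; apply: prodr_ge0 => q /path_weight_good[].
set x := fine (P B).
have xE : P B = x%:E by rewrite /x fineK// fin_num_measure.
(* Markov's inequality for [expR (- X)] along the walk. The constant 3/2 adds 1/2 from the root to
   the bound 1 on the telescoping sum. *)
have PB n : x <= expR (M%:R + 3 / 2 - p / 2 * \sum_(k < n) k.+2%:R^-1).
  rewrite -addrA expRD -ler_pdivrMl ?expR_gt0// -expRN -lee_fin.
  apply: (@le_trans _ _ (\int[P]_w (\sum_(r <- words n) G r w)%:E)%E).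
    rewrite EFinM -xE -[X in P X]setIT -integral_indic// -ge0_integralZl//; last first.
      by apply/measurable_EFinP; exact: measurable_indic.
    apply: ge0_le_integral => //.
    - by apply/measurable_EFinP; apply: measurable_funM => //; exact: measurable_indic.
    - by apply/measurable_EFinP; exact: measurable_sum.
    - move=> w _; rewrite -EFinM lee_fin indicE; case: (boolP (w \in B)); last first.
        by rewrite mulr0 => _; exact: sumr_ge0.
      rewrite inE mulr1 => wB; have [r rn Gr] := path_weight_selected n w.
      rewrite (big_rem r)//= Gr -[leLHS]addr0 lerD ?sumr_ge0//.
      rewrite ler_expR lerN2 -YE (le_trans (ler_norm _))//.
      exact: wB.
  under eq_integral do rewrite -sumEFin.
  rewrite ge0_integral_sum//; last 2 first.
  - by move=> r; exact/measurable_EFinP.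
  - by move=> r w _; rewrite lee_fin.
  apply: (@le_trans _ _ (\sum_(r <- words n) (path_bound r)%:E)%E).
    by apply: lee_sum => r _; exact: path_weight_le.
  rewrite sumEFin lee_fin sum_path_bound.
  apply: le_trans (ler_wpM2l (expR_ge0 _) (prod_factor_le n)) _.
  rewrite -expRD ler_expR.
  have : 0 <= n.+1%:R^-1 :> R by rewrite invr_ge0.
  by move: (n.+1%:R^-1) (p / 2 * _) => m A; lra.
rewrite xE; congr EFin; apply/eqP; rewrite eq_le fine_ge0 ?measure_ge0// andbT.
rewrite leNgt; apply/negP => x0.
(* If [x] were positive, such an [n] makes the exponent at most [- x^-1], while exp(-1/x) < x
   because exp(1/x) is at least 1 + 1/x. *)
have [n An] := shifted_harmonic_dvg ((M%:R + 3 / 2 + x^-1) / (p / 2)).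
have := PB n; apply/negP; rewrite -ltNge.
apply: (@le_lt_trans _ _ (expR (- x^-1))).
  rewrite ler_expR; move: An; rewrite ler_pdivrMr ?divr_gt0// [leRHS]mulrC.
  by move: (x^-1) (p / 2 * _) => y A; lra.
rewrite expRN invf_plt ?posrE ?expR_gt0//.
by apply: lt_le_trans (expR_ge1Dx _); rewrite ltrDr.
Qed.

End gaussian_tree_unbounded.

Theorem corollary6p2 (R : realType) (d : measure_display)
    (Omega : measurableType d) (P : probability Omega R)
    (xi : binary_tree -> {RV P >-> R})
    (xi_indep : mutually_independent xi)
    (xi_normal : forall v, standard_normal (xi v)) :
  as_bounded P (fun (t : binary_tree) w =>
    ((depth t).+1%:R)^-1 * \sum_(v \in [set v | tree_le v t]) xi v w) /\
  as_unbounded P (fun (t : binary_tree) w =>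
    \sum_(v \in [set v | tree_le v t]) ((depth v).+1%:R)^-1 * xi v w).
Proof.
split; first exact: branch_mean_as_bounded.
exact: weighted_branch_sum_as_unbounded.
Qed.
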